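(* Let $X$ be a finite latin left quasigroup that is right linear over a group $(G,\circ)$, with $x\cdot y=\phi(x)\circ\psi(y)$ for all $x,y$, where $\phi:G\to G$ is a map and $\psi\in\mathrm{Aut}(G,\circ)$. Then the congruences of $X$ are in one-to-one correspondence with the normal subgroups $H$ of $G$ that are invariant under $\psi$ and $\phi$.
   Context: A left quasigroup $(X,\cdot)$ is a non-empty set with a binary operation such that $\sigma_x:y\mapsto x\cdot y$ is bijective for every $x$; it is latin if moreover $\delta_x:y\mapsto y\cdot x$ is bijective for every $x$. A left quasigroup $X$ is right linear over a group $(G,\circ)$ if $X=G$ as sets and there are a map $\phi:G\to G$ and $\psi\in\mathrm{Aut}(G,\circ)$ with $x\cdot y=\phi(x)\circ\psi(y)$ for all $x,y$. A congruence of $X$ is an equivalence relation $\sim$ such that $x\sim x'$ and $y\sim y'$ imply $x\cdot y\sim x'\cdot y'$ and $\sigma_x^{-1}(y)\sim\sigma_{x'}^{-1}(y')$. A normal subgroup $H$ of $G$ is invariant under a map $f:G\to G$ if $x^{-1}y\in H$ implies $f(x)^{-1}f(y)\in H$ for all $x,y\in G$. *)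

(* Defs.v *)
From mathcomp Require Import all_boot all_fingroup.
From mathcomp Require Import classical_sets functions.

Set Implicit Arguments.
Unset Strict Implicit.
Unset Printing Implicit Defensive.

Import GroupScope.

(* The map sigma_x is [op x] and the map delta_x is [op^~ x]. *)

Definition left_quasigroup (X : Type) (op : X -> X -> X) : Prop :=
  inhabited X /\ (forall x : X, bijective (op x)).

Definition latin (X : Type) (op : X -> X -> X) : Prop :=
  left_quasigroup op /\ (forall x : X, bijective (op^~ x)).

(* The left quasigroup has the same carrier as the group. *)
Definition right_linear (gT : finGroupType) (op : gT -> gT -> gT)
    (phi : gT -> gT) (psi : {perm gT}) : Prop :=
  psi \in Aut [set: gT] /\ (forall x y : gT, op x y = phi x * psi y).

(* On a finite carrier an equivalence relation is a boolean relation, and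
   [finv (op x)] is the inverse of [op x] whenever the latter is bijective. *)
Definition congruence (X : finType) (op : X -> X -> X) : set (rel X) :=
  fun R => [/\ equivalence_rel R,
    (forall x x' y y' : X, R x x' -> R y y' -> R (op x y) (op x' y')) &
    (forall x x' y y' : X, R x x' -> R y y' ->
       R (finv (op x) y) (finv (op x') y'))].

Definition invariant_under (gT : finGroupType) (H : {group gT})
    (f : gT -> gT) : Prop :=
  forall x y : gT, x^-1 * y \in H -> (f x)^-1 * f y \in H.

Definition invariant_normal_subgroup (gT : finGroupType)
    (phi : gT -> gT) (psi : {perm gT}) : set {group gT} :=
  fun H => [/\ H <| [set: gT], invariant_under H psi & invariant_under H phi].

Definition coset_rel (gT : finGroupType) (H : {group gT}) : rel gT :=
  fun x y => x^-1 * y \in H.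

(* Main.v *)
(* The translations of a latin right linear left quasigroup generate all left
   translations of the group: if [phi e = 1] then [op e] is [psi], and
   [op x (psi^-1 y) = phi x * y] with [phi] surjective.  A congruence is
   therefore invariant under left translations, so it is the coset relation of
   the class of 1.  It is preserved by [phi], since [phi x = op x 1], and by
   finiteness also reflected by [phi]; writing elements as [phi x] and using
   [op x y = phi x * psi y] shows that it is invariant under right translations
   too, which makes the class of 1 normal. *)
Require Import Defs.
From mathcomp Require Import all_boot all_fingroup.
From mathcomp Require Import boolp classical_sets functions.

Set Implicit Arguments.
Unset Strict Implicit.
Unset Printing Implicit Defensive.

Local Open Scope group_scope.

(** The map induced by [f] on pairs is injective and sends the finite graph of [R] into itself,
    hence onto itself; by injectivity, a pair whose image is related is itself related. *)
Lemma inj_homo_rel_mono (T : finType) (f : T -> T) (R : rel T) :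
  injective f -> {homo f : x y / R x y} -> {mono f : x y / R x y}.
Proof.
move=> finj fR x y; apply/idP/idP => [Rfxy|/fR //].
pose g (p : T * T) := (f p.1, f p.2).
pose E := [set p : T * T | R p.1 p.2]%SET.
have ginj : injective g by move=> [a b] [c d] [/finj-> /finj->].
have gE : g @: E = E.
  apply/eqP; rewrite eqEcard card_imset // leqnn andbT.
  by apply/fintype.subsetP => _ /imsetP[p pE ->]; move: pE; rewrite !inE; apply: fR.
have : g (x, y) \in E by rewrite inE.
by rewrite -gE mem_imset // inE.
Qed.

Lemma coset_rel_equivalence (gT : finGroupType) (H : {group gT}) :
  equivalence_rel (coset_rel H).
Proof.
move=> x y z; rewrite /coset_rel mulVg group1; split=> // Hxy.
by rewrite -(groupMl (y^-1 * z) Hxy) mulgA mulgK.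
Qed.

Lemma coset_rel_inj (gT : finGroupType) : injective (@coset_rel gT).
Proof.
move=> H K HK; apply/group_inj/setP => x.
by have := congr1 (fun R : rel gT => R 1 x) HK; rewrite /coset_rel invg1 mul1g.
Qed.

Lemma coset_rel_mul (gT : finGroupType) (H : {group gT}) (x x' y y' : gT) :
  H <| [set: gT] -> coset_rel H x x' ->
  coset_rel H (x * y) (x' * y') = coset_rel H y y'.
Proof.
move=> /normal_norm nH Hx; rewrite /coset_rel.
have -> : (x * y)^-1 * (x' * y') = (x^-1 * x') ^ y * (y^-1 * y').
  by rewrite conjgE invMg !mulgA mulgK.
by rewrite groupMl // memJ_norm // (fintype.subsetP nH) // inE.
Qed.

(** [H] is the class of 1: from [R 1 y], translation by [x] gives [R x (x * y)], and transitivity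
    gives closure under products, which suffices in a finite group. *)
Lemma left_invariant_coset_rel (gT : finGroupType) (R : rel gT) :
  equivalence_rel R -> (forall a, {homo (fun z => a * z) : x y / R x y}) ->
  exists H : {group gT}, coset_rel H = R.
Proof.
move=> eqR mulR.
have gH : group_set [set x | R 1 x]%SET.
  apply/group_setP; split=> [|x y]; rewrite !inE; first by have [] := eqR 1 1 1.
  move=> R1x /(mulR x); rewrite mulg1.
  by have [_ ->] := eqR 1 x (x * y).
exists (Group gH); apply/funext => x; apply/funext => y.
rewrite /coset_rel inE; apply/idP/idP => [/(mulR x)|/(mulR x^-1)].
  by rewrite mulg1 mulVKg.
by rewrite mulVg.
Qed.

Lemma right_invariant_coset_rel_normal (gT : finGroupType) (H : {group gT}) :
  (forall a, {homo (fun z => z * a) : x y / coset_rel H x y}) -> H <| [set: gT].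
Proof.
move=> mulH; rewrite /normal finset.subsetT; apply/fintype.subsetP => a _; rewrite inE.
apply/fintype.subsetP => _ /imsetP[x Hx ->].
have /(mulH a) : coset_rel H 1 x by rewrite /coset_rel invg1 mul1g.
by rewrite /coset_rel mul1g conjgE.
Qed.

Section LatinRightLinear.

Variables (gT : finGroupType) (op : gT -> gT -> gT).
Variables (phi : gT -> gT) (psi : {perm gT}).
Hypotheses (op_latin : latin op) (op_lin : right_linear op phi psi).

Lemma opE x y : op x y = phi x * psi y.
Proof. by have [_ ->] := op_lin. Qed.

Lemma psi1 : psi 1 = 1.
Proof.
have [/Aut_morphic/morphicP psiM _] := op_lin.
by apply: (mulgI (psi 1)); rewrite -psiM ?inE // !mulg1.
Qed.

Lemma op1 x : op x 1 = phi x.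
Proof. by rewrite opE psi1 mulg1. Qed.

(** [phi] is the map delta at 1, bijective by latinity. *)
Lemma phi_bij : bijective phi.
Proof. by have [_ /(_ 1)/eq_bij] := op_latin; apply => x; rewrite /= op1. Qed.

Lemma op_inj x : injective (op x).
Proof. by have [[_ /(_ x)/bij_inj]] := op_latin. Qed.

Lemma coset_rel_congruence (H : {group gT}) :
  invariant_normal_subgroup phi psi H -> congruence op (coset_rel H).
Proof.
move=> [nH Hpsi Hphi].
have psi_mono : {mono psi : x y / coset_rel H x y}.
  exact: inj_homo_rel_mono (@perm_inj _ psi) Hpsi.
(* Being an equality, this serves both compatibility with [op] and, read backwards at the preimages,
   compatibility with [finv]. *)
have opR x x' y y' : coset_rel H x x' ->
    coset_rel H (op x y) (op x' y') = coset_rel H y y'.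
  by move=> /Hphi Hx; rewrite !opE coset_rel_mul.
split=> [|x x' y y' Hx|x x' y y' Hx Hy]; first exact: coset_rel_equivalence.
  by rewrite opR.
by rewrite -(opR x x') // !f_finv //; apply: op_inj.
Qed.

Lemma congruence_coset_rel (R : rel gT) : congruence op R ->
  exists2 H : {group gT}, invariant_normal_subgroup phi psi H & coset_rel H = R.
Proof.
move=> [eqR opR _]; have Rxx x : R x x by have [] := eqR x x x.
have [phiI phiK phiIK] := phi_bij.
have phiR : {homo phi : x y / R x y}.
  by move=> x y Rxy; rewrite -!op1; apply: opR.
have psiR : {homo psi : x y / R x y}.
  (* Since [phi (phiI 1) = 1], the map [op (phiI 1)] is [psi]. *)
  move=> x y /(opR _ _ _ _ (Rxx (phiI 1))).
  by rewrite !opE phiIK !mul1g.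
have phi_mono := inj_homo_rel_mono (can_inj phiK) phiR.
have psi_mono := inj_homo_rel_mono (@perm_inj _ psi) psiR.
(* The product [x * y] is [op] of the preimages of [x] under [phi] and of [y] under [psi], and both
   maps reflect [R]. Fixing either factor yields left and right invariance. *)
have mulR x x' y y' : R x x' -> R y y' -> R (x * y) (x' * y').
  rewrite -{1}[x]phiIK -{1}[x']phiIK phi_mono => Rx.
  rewrite -{1}[y](permKV psi) -{1}[y'](permKV psi) psi_mono => /(opR _ _ _ _ Rx).
  by rewrite !opE !phiIK !permKV.
have [H HR] : exists H : {group gT}, coset_rel H = R.
  by apply: left_invariant_coset_rel => // a x y; apply: mulR.
exists H => //; split; last 2 first.
- by move=> x y; rewrite -!/(coset_rel H _ _) HR; apply: psiR.
- by move=> x y; rewrite -!/(coset_rel H _ _) HR; apply: phiR.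
apply: right_invariant_coset_rel_normal => a x y.
by rewrite HR => Rxy; apply: mulR.
Qed.

End LatinRightLinear.

Theorem proposition31 (gT : finGroupType) (op : gT -> gT -> gT)
    (phi : gT -> gT) (psi : {perm gT})
    (hlatin : latin op) (hlin : right_linear op phi psi) :
  set_bij (invariant_normal_subgroup phi psi) (congruence op) (@coset_rel gT).
Proof.
split=> [H|H K _ _|R].
- exact: coset_rel_congruence.
- exact: coset_rel_inj.
- by case/(congruence_coset_rel hlatin hlin) => H; exists H.
Qed.
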